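(* Let $k$ be a field and let $\mathcal G$ be an induced hypergraph of a $d$-uniform hypergraph $\mathcal H$ such that $\mathcal G$ is not homologically connected over $k$. Then $$\beta_{|\mathcal X(\mathcal G)|-d+1}(R/I_{\Delta(\mathcal H)})\neq 0 .$$
   Context: A hypergraph $\mathcal H$ consists of a finite vertex set $\mathcal X(\mathcal H)$ and a finite collection $\mathcal E(\mathcal H)$ of subsets, called edges; it is $d$-uniform if every edge has cardinality $d$. All hypergraphs are simple (every edge has at least two vertices, so $d\ge 2$, and no edge contains another). For $\mathcal Y\subseteq\mathcal X(\mathcal H)$, the induced hypergraph on $\mathcal Y$ has vertex set $\mathcal Y$ and as edges all edges of $\mathcal H$ contained in $\mathcal Y$. The clique complex is $\Delta(\mathcal H)=\{F\subseteq\mathcal X(\mathcal H): \text{every } d\text{-subset of }F\text{ is an edge of }\mathcal H\}$. For a simplicial complex $\Delta$ and a set $V$ of vertices, $\Delta_V=\{F\in\Delta: F\subseteq V\}$. The connectivity over $k$ of a $d$-uniform hypergraph $\mathcal H$ on vertex set $[n]$ is $\mathrm{con}(\mathcal H)=\min\{|V| : V\subseteq[n],\ \dim_k\tilde H_{d-2}(\Delta(\mathcal H)_{[n]\setminus V};k)\neq0\}$ (infinite if there is no such $V$), where $\tilde H$ denotes reduced simplicial homology. $\mathcal H$ is homologically connected over $k$ if $\mathrm{con}(\mathcal H)\ne0$. $R$ is the polynomial ring over $k$ with variables indexed by $\mathcal X(\mathcal H)$, $I_\Delta$ is the Stanley–Reisner ideal of $\Delta$, and $\beta_i(M)=\dim_k\mathrm{Tor}_i^R(M,k)$.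 *)

(* Defs.v *)
From HB Require Import structures.
From mathcomp Require Import all_boot all_order all_algebra.
From mathcomp Require Import generic_quotient ring_quotient.
From mathcomp Require Import mpoly freeg.
From mathcomp Require Import boolp.

Set Implicit Arguments.
Unset Strict Implicit.
Unset Printing Implicit Defensive.

Import GRing.Theory.
Local Open Scope ring_scope.
Local Open Scope quotient_scope.

(* A hypergraph is indexed by its vertex set, which is the whole finType [T]. *)
Record hypergraph (T : finType) := Hypergraph {
  edges : {set {set T}};
  edge_gt1 : forall e, e \in edges -> (1 < #|e|)%N;
  edge_antichain : forall e f,
    e \in edges -> f \in edges -> e \subset f -> e = f
}.

Definition uniform (T : finType) (d : nat) (H : hypergraph T) : Prop :=
  forall e, e \in edges H -> #|e| = d.

Section Induced.
Variables (T : finType) (H : hypergraph T) (Y : {set T}).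

Definition induced_edges : {set {set {x : T | x \in Y}}} :=
  [set e : {set {x : T | x \in Y}} | val @: e \in edges H].

Lemma induced_edge_gt1 e : e \in induced_edges -> (1 < #|e|)%N.
Proof. by rewrite inE => /edge_gt1; rewrite card_imset //; apply: val_inj. Qed.

Lemma induced_edge_antichain e f :
  e \in induced_edges -> f \in induced_edges -> e \subset f -> e = f.
Proof.
rewrite !inE => eH fH ef; apply: (imset_inj val_inj).
by apply: (edge_antichain eH fH); apply: imsetS.
Qed.

Definition induced : hypergraph {x : T | x \in Y} :=
  Hypergraph induced_edge_gt1 induced_edge_antichain.

End Induced.

Definition clique_complex (T : finType) (d : nat) (H : hypergraph T) :
    {set {set T}} :=
  [set F : {set T} | [forall e : {set T},
     (e \subset F) && (#|e| == d) ==> (e \in edges H)]].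

Definition restrict (T : finType) (D : {set {set T}}) (V : {set T}) :
    {set {set T}} :=
  [set F in D | F \subset V].

Section ReducedHomology.
Variables (k : fieldType) (T : finType) (D : {set {set T}}).

Definition faces (c : nat) : {set {set T}} := [set F in D | #|F| == c].

(* Vertices are ordered by [enum_rank]; chains are row vectors, so [bdry c]
   maps chains on faces with c+1 elements to chains on faces with c elements
   (c = 0 being the augmentation onto the empty face). *)
Definition bdry (c : nat) : 'M[k]_(#|faces c.+1|, #|faces c|) :=
  \matrix_(i, j)
    let F : {set T} := enum_val i in
    \sum_(x in F | F :\ x == enum_val j)
      (-1) ^+ #|[set y in F | (enum_rank y < enum_rank x)%N]|.

(* Dimension of the j-th reduced homology, j >= 0; j-chains live on faces with
   j+1 elements.  The image of [bdry j.+1] lies in the kernel of [bdry j], so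
   the truncated subtraction is the true one. *)
Definition reduced_homology_dim (j : nat) : nat :=
  (\rank (kermx (bdry j)) - \rank (bdry j.+1))%N.

End ReducedHomology.

(* [None] stands for infinity. *)
Definition con (k : fieldType) (T : finType) (d : nat) (H : hypergraph T) :
    option nat :=
  let P (V : {set T}) :=
    reduced_homology_dim k (restrict (clique_complex d H) (~: V)) (d - 2)
      != 0%N in
  omap (fun V0 => #|[arg min_(V < V0 | P V) #|V|]|) [pick V | P V].

Definition homologically_connected (k : fieldType) (T : finType) (d : nat)
    (H : hypergraph T) : Prop :=
  con k d H <> Some 0%N.

Section QuotientModule.
Variables (R : nzRingType) (V : lmodType R) (S : submodClosed V).

Definition submod_pred : {pred V} := fun v => v \in S.
HB.instance Definition _ :=
  GRing.isSubmodClosed.Build R V submod_pred (GRing.submodClosedP S).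

Definition quotmod : Type := Quotient.quot submod_pred.
HB.instance Definition _ := ZmodQuotient.on quotmod.

Definition quotmod_scale (a : R) (q : quotmod) : quotmod :=
  \pi_quotmod (a *: (repr q : V)).

Lemma quotmod_scale_pi a (v : V) :
  quotmod_scale a (\pi_quotmod v) = \pi_quotmod (a *: v).
Proof.
apply/eqP; rewrite /quotmod_scale piE Quotient.equivE -scalerBr.
have /eqmodP: repr (\pi_quotmod v) = v %[mod quotmod] by rewrite reprK.
exact: rpredZ.
Qed.

Lemma quotmod_scaleA a b q :
  quotmod_scale a (quotmod_scale b q) = quotmod_scale (a * b) q.
Proof.
elim/quotW: q => v.
by rewrite (quotmod_scale_pi b v) !quotmod_scale_pi scalerA.
Qed.

Lemma quotmod_scale1 : left_id 1 quotmod_scale.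
Proof. by elim/quotW=> v; rewrite quotmod_scale_pi scale1r. Qed.

Lemma quotmod_scaleDr : right_distributive quotmod_scale +%R.
Proof.
move=> a; elim/quotW=> u; elim/quotW=> v.
rewrite (quotmod_scale_pi a u) (quotmod_scale_pi a v).
have piD x y : \pi_quotmod x + \pi_quotmod y = \pi_quotmod (x + y).
  by rewrite -raddfD.
by rewrite [X in quotmod_scale a X]piD piD quotmod_scale_pi scalerDr.
Qed.

Lemma quotmod_scaleDl q : {morph quotmod_scale^~ q : a b / a + b}.
Proof.
move=> a b; elim/quotW: q => v.
by rewrite !quotmod_scale_pi scalerDl raddfD.
Qed.

HB.instance Definition _ := GRing.Zmodule_isLmodule.Build R quotmod
  quotmod_scaleA quotmod_scale1 quotmod_scaleDr quotmod_scaleDl.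

End QuotientModule.

(* The syzygy module of [M]: the kernel of the canonical surjection onto [M]
   from the free module on the underlying set of [M]. *)
Section Syzygy.
Variables (R : nzRingType) (M : lmodType R).

Definition free_cover (u : {freeg M / R}) : M := fglift id u.

Lemma free_coverE u :
  free_cover u = \sum_(x <- dom u) coeff x u *: x.
Proof.
pose f := GRing.isZmodMorphism.Build _ _ _ (lift_is_additive (id : M -> M)).
pose F : {additive {freeg M / R} -> M} := HB.pack (fglift (id : M -> M)) f.
rewrite /free_cover -{1}[u]freeg_sumE -[fglift _ _]/(F _) raddf_sum.
by apply: eq_bigr => x _; rewrite /= liftU.
Qed.

Definition syzygy_pred : {pred {freeg M / R}} := [pred u | free_cover u == 0].

Lemma syzygy_closed : submod_closed syzygy_pred.
Proof.
have liftB := lift_is_additive (id : M -> M).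
have lift0 : free_cover 0 = 0 by rewrite -[0]subr0 /free_cover liftB subrr.
have liftD u v : free_cover (u + v) = free_cover u + free_cover v.
  rewrite /free_cover -{1}[v]opprK liftB -[- v]add0r liftB.
  by rewrite -/(free_cover 0) lift0 add0r opprK.
have liftZ a u : free_cover (a *: u) = a *: free_cover u.
  rewrite -[a *: u]/(fgscale a u) /fgscale [in RHS]free_coverE.
  elim: (dom u) => [|x s IHs]; first by rewrite !big_nil lift0 scaler0.
  rewrite !big_cons liftD IHs scalerDr; congr (_ + _).
  by rewrite /free_cover liftU scalerA.
split=> [|a u v]; rewrite !inE ?lift0 // => /eqP u0 /eqP v0.
by rewrite liftD liftZ u0 v0 scaler0 addr0.
Qed.

HB.instance Definition _ :=
  GRing.isSubmodClosed.Build R {freeg M / R} syzygy_pred syzygy_closed.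

Record syzygy_sort := Syzygy {
  syzygy_val : {freeg M / R};
  syzygy_valP : syzygy_val \in syzygy_pred
}.
HB.instance Definition _ := [isSub for syzygy_val].
HB.instance Definition _ := [Choice of syzygy_sort by <:].
HB.instance Definition _ := [SubChoice_isSubLmodule of syzygy_sort by <:].

Definition syzygy : lmodType R := syzygy_sort.

End Syzygy.

(* The dimension of Z/B, for subspaces B and Z of V with B contained in Z:
   [Some b] if it has a basis of b elements and [None] if it is infinite. *)
Section SubquotientDimension.
Variables (k : fieldType) (V : lmodType k) (Z B : V -> Prop).

Definition is_subquot_dim (b : nat) : Prop :=
  exists2 s : 'I_b -> V, (forall j, Z (s j)) &
    forall v, Z v ->
      exists! a : {ffun 'I_b -> k}, B (v - \sum_j a j *: s j).

Definition subquot_dim : option nat :=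
  if pselect (exists b, is_subquot_dim b) is left h
  then Some (projT1 (cid h)) else None.

End SubquotientDimension.

(* Tor_i(M, k) over R, where R acts on k through [phi].  It is computed from
   the canonical free resolution  ... -> F_1 -> F_0 -> M  in which F_i is free
   on the underlying set of the i-th syzygy module of M.  F_{i+1} -> F_i sends a
   basis element, that is an element of the kernel of F_i -> syz_i(M), to
   itself.  Tensoring with k turns F_i into the k-vector space on the same
   basis and applies [phi] to the coefficients of the differential. *)
Section Tor.
Variables (R : comNzRingType) (k : fieldType) (phi : {rmorphism R -> k}).
Variable (M : lmodType R).

Definition base_change (K : choiceType) (u : {freeg K / R}) : {freeg K / k} :=
  \sum_(x <- dom u) << phi (coeff x u) *g x >>.

Definition syz (i : nat) : lmodType R := iter i (@syzygy R) M.

Definition tor_chains (i : nat) : lmodType k := {freeg (syz i) / k}.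

Definition tor_diff (i : nat) : tor_chains i.+1 -> tor_chains i :=
  fglift (fun z : syz i.+1 => base_change (syzygy_val z) : tor_chains i).

Definition tor_cycle (i : nat) : tor_chains i -> Prop :=
  if i is j.+1 then fun v => tor_diff v = 0 else fun _ => True.

Definition tor_boundary (i : nat) (v : tor_chains i) : Prop :=
  exists u : tor_chains i.+1, v = tor_diff u.

Definition tor_dim (i : nat) : option nat :=
  subquot_dim (@tor_cycle i) (@tor_boundary i).

End Tor.

(* k is the quotient of the polynomial ring by the ideal of the variables, so a
   polynomial acts on it through its value at 0. *)
Definition betti (k : fieldType) (n : nat) (i : nat)
    (M : lmodType {mpoly k[n]}) : option nat :=
  tor_dim (meval (fun _ : 'I_n => 0 : k)) M i.

Section StanleyReisner.
Variables (k : fieldType) (T : finType) (D : {set {set T}}).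

Definition poly_ring : comNzRingType := {mpoly k[#|T|]}.

Definition face_monomial (F : {set T}) : poly_ring :=
  \prod_(x in F) 'X_(enum_rank x).

Definition sr_ideal : {pred poly_ring^o} := fun p =>
  `[< exists c : {set T} -> poly_ring,
        p = \sum_(F : {set T} | F \notin D) c F * face_monomial F >].

Lemma sr_ideal_closed : submod_closed sr_ideal.
Proof.
split=> [|a p q /asboolP[c ->] /asboolP[c' ->]]; apply/asboolP.
  by exists (fun=> 0); rewrite big1 // => F _; rewrite mul0r.
exists (fun F => a * c F + c' F); rewrite /GRing.scale /= mulr_sumr -big_split.
by apply: eq_bigr => F _; rewrite /= mulrDl mulrA.
Qed.

HB.instance Definition _ :=
  GRing.isSubmodClosed.Build poly_ring poly_ring^o sr_ideal sr_ideal_closed.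

(* R/I as an R-module. *)
Definition sr_quotient : lmodType poly_ring := quotmod sr_ideal.

End StanleyReisner.

(* Main.v *)
(* Tor_i(R/I, k) is detected by the Koszul complex: along the canonical free
   resolution, the connecting maps carry a nonzero class of H_i(K(R/I)) to an
   element of syz_i(R/I) outside (x_1, ..., x_n) syz_i(R/I), because K(F) is
   exact in positive degrees for F free.  In the multidegree of the vertex set
   of G, K(R/I) is the reduced simplicial cochain complex of the clique complex
   of G: x^F e_S corresponds to the face F complementary to S.  A nonzero class
   in degree d-2 of homology gives one in cohomology, where |F| = d-1 and hence
   |S| = |X(G)| - d + 1. *)
Require Import Defs.
From HB Require Import structures.
From mathcomp Require Import all_boot all_order all_algebra.
From mathcomp Require Import generic_quotient ring_quotient.
From mathcomp Require Import mpoly freeg boolp.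

Set Implicit Arguments.
Unset Strict Implicit.
Unset Printing Implicit Defensive.

Import GRing.Theory.
Local Open Scope ring_scope.

Section Koszul.
Variables (R : comNzRingType) (I : finType) (x : I -> R) (rho tau : I -> nat).

Definition koszul_sign (s : I) (S : {set I}) : R :=
  (-1) ^+ (#|[set y in S | (rho y < rho s)%N]| + tau s).

(* [c S] is the coefficient of the basis element [e_S] of the exterior algebra.
   The twist [tau] replaces [x s] by [(-1) ^+ tau s * x s]. *)
Definition koszul (V : lmodType R) (c : {set I} -> V) (S : {set I}) : V :=
  \sum_(s | s \notin S) koszul_sign s S *: (x s *: c (s |: S)).

Lemma koszul_signK s S : koszul_sign s S * koszul_sign s S = 1.
Proof. by rewrite -expr2 sqrr_sign. Qed.

Lemma koszul_signU1 s t (S : {set I}) : t \notin S ->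
  koszul_sign s (t |: S) = (-1) ^+ (rho t < rho s)%N * koszul_sign s S.
Proof.
move=> tS; rewrite /koszul_sign -exprD addnA; congr (_ ^+ (_ + _)).
case: ltnP => ts.
  have -> : [set y in t |: S | (rho y < rho s)%N]
      = t |: [set y in S | (rho y < rho s)%N].
    by apply/setP => y; rewrite !inE; case: eqP => [->|].
  by rewrite cardsU1 !inE (negPf tS).
rewrite add0n; apply: eq_card => y; rewrite !inE.
case: eqP => [->|_]; last by [].
by rewrite (negPf tS) ltnNge ts.
Qed.

Hypothesis rhoI : injective rho.

Lemma koszul_signC s t (S : {set I}) : s != t -> s \notin S -> t \notin S ->
  koszul_sign s (t |: S) * koszul_sign t S
    = - (koszul_sign t (s |: S) * koszul_sign s S).
Proof.
move=> st sS tS; rewrite !koszul_signU1 //.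
have: rho s != rho t by apply: contra_neq st => /rhoI.
by case: ltngtP => // _ _; rewrite !expr0 !expr1 !mulN1r !mul1r ?opprK ?mulNr
  ?opprK mulrC.
Qed.

Lemma koszul_signUU s t (S : {set I}) : s != t -> s \notin S -> t \notin S ->
  koszul_sign s (t |: S) * koszul_sign t (s |: S)
    = - (koszul_sign t S * koszul_sign s S).
Proof.
move=> st sS tS; rewrite -[LHS]mul1r -(koszul_signK t S) mulrACA.
rewrite [X in X * _]mulrC koszul_signC // mulNr mulrC mulrA -(mulrA (_ t S)).
by rewrite koszul_signK mulr1.
Qed.

Lemma koszulB (V : lmodType R) (c1 c2 : {set I} -> V) (S : {set I}) :
  koszul (fun A => c1 A - c2 A) S = koszul c1 S - koszul c2 S.
Proof. by rewrite -sumrB; apply: eq_bigr => s _; rewrite !scalerBr. Qed.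

Lemma eq_koszul (V : lmodType R) (c1 c2 : {set I} -> V) :
  c1 =1 c2 -> koszul c1 =1 koszul c2.
Proof. by move=> e S; apply: eq_bigr => s _; rewrite e. Qed.

Lemma koszul_linear (V W : lmodType R) (f : V -> W) (c : {set I} -> V) S :
  linear f -> koszul (fun A => f (c A)) S = f (koszul c S).
Proof.
move=> f_lin; pose F : {linear V -> W} :=
  HB.pack f (GRing.isLinear.Build _ _ _ _ f f_lin).
have FZ a v : F (a *: v) = a *: F v by exact: linearZ.
by rewrite -[f]/(F : V -> W) linear_sum; apply: eq_bigr => s _; rewrite !FZ.
Qed.

Lemma koszul_koszul (V : lmodType R) (c : {set I} -> V) (S : {set I}) :
  koszul (koszul c) S = 0.
Proof.
pose a s t : V := (koszul_sign s S * koszul_sign t (s |: S) * x s * x t) *: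
  c (t |: (s |: S)).
pose P s t := [&& s \notin S, t \notin S & t != s].
have aN s t : P s t -> a s t = - a t s.
  case/and3P => sS tS ts; rewrite /a setUCA -scaleNr; congr (_ *: _).
  rewrite ![koszul_sign _ S * _]mulrC koszul_signC // !mulNr; congr (- _).
  by rewrite -!mulrA; congr (_ * _); congr (_ * _); rewrite mulrC.
have -> : koszul (koszul c) S = \sum_s \sum_(t | P s t) a s t.
  rewrite [LHS]big_mkcond; apply: eq_bigr => s _; rewrite /P; case: ifP => sS.
    rewrite /koszul !scaler_sumr; apply: eq_big => [t|t _].
      by rewrite !inE negb_or andbC.
    rewrite !scalerA; congr (_ *: _); rewrite -!mulrA; congr (_ * _).
    by rewrite mulrCA.
  by rewrite big_pred0.
rewrite pair_big_dep /= (bigID (fun p => rho p.1 < rho p.2)%N) /=.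
have swapI : injective (fun p : I * I => (p.2, p.1)).
  by move=> [? ?] [? ?] [-> ->].
rewrite [X in _ + X](reindex_inj swapI) /=.
rewrite [X in _ + X](eq_bigl (fun p => P p.1 p.2 && (rho p.1 < rho p.2)%N)).
  rewrite -big_split big1 // => p /= /andP[Pp _].
  by rewrite (aN _ _ Pp) addrC subrr.
case=> s t /=; rewrite -leqNgt /P leq_eqVlt.
have [->|st] := eqVneq s t; first by rewrite !andbF.
have -> : (rho s == rho t) = false.
  by apply/eqP => /rhoI e; rewrite e eqxx in st.
by case: (s \in S) => //=; case: (t \in S) => //=; rewrite ?orbF ?andbT.
Qed.

End Koszul.

Section KoszulExact.
Variables (k : fieldType) (n : nat) (rho tau : 'I_n -> nat).
Hypothesis rhoI : injective rho.
Local Notation R := {mpoly k[n]}.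
Local Notation X := (fun s : 'I_n => 'X_s : R).
Local Notation sgn := (koszul_sign k rho tau).
Local Notation K := (koszul X rho tau).

Lemma mcoeff_sign (e : nat) (p : R) m : ((-1) ^+ e * p)@_m = (-1) ^+ e * p@_m.
Proof.
elim: e => [|e IHe]; first by rewrite !expr0 !mul1r.
by rewrite !exprS -!mulrA !mulN1r mcoeffN IHe.
Qed.

Lemma mcoeffXUM (s : 'I_n) (p : R) m :
  ('X_s * p)@_m = if (0 < m s)%N then p@_(m - U_(s))%MM else 0.
Proof.
case: ifP => ms.
  have le_sm : (U_(s) <= m)%MM by rewrite lep1mP -lt0n.
  by rewrite mulrC -{1}[m](submK le_sm) addmC mcoeffMX.
rewrite mcoeffM big1 // => -[m1 m2] /= /eqP e; rewrite mcoeffX.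
case: eqP => [e1|]; last by rewrite mul0r.
move/(congr1 (fun b : 'X_{1..n} => b s)): e.
by rewrite mnmDE -e1 mnm1E eqxx => e; rewrite e in ms.
Qed.

Definition set_mnm (S : {set 'I_n}) : 'X_{1..n} :=
  [multinom (i \in S : nat) | i < n].

(* The monomial homotopy preserves the multidegree [m + set_mnm S] of
   ['X_[m] e_S]; it contracts the strand of multidegree [b] along the variable
   [mnm_pivot b], so only the strand of multidegree 0 survives. *)
Definition mnm_pivot (b : 'X_{1..n}) : option 'I_n := [pick i | (0 < b i)%N].

Definition koszul_lift_coeff (c : {set 'I_n} -> R) S (m : 'X_{1..n}) : k :=
  if mnm_pivot (m + set_mnm S)%MM is Some v then
    if v \in S then
      sgn v (S :\ v) * (c (S :\ v))@_(m + U_(v))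
    else 0
  else 0.

Definition koszul_lift (c : {set 'I_n} -> R) S : R :=
  \sum_(m : 'X_{1..n < \max_A msize (c A)}) koszul_lift_coeff c S m *: 'X_[m].

Lemma mcoeff_koszul_lift c S m :
  (koszul_lift c S)@_m = koszul_lift_coeff c S m.
Proof.
rewrite /koszul_lift; case: (ltnP (mdeg m) (\max_A msize (c A))) => hm.
  by rewrite mcoeff_mpoly.
rewrite raddf_sum big1 /= => [|[m' lt_m'] _ /=].
  rewrite /koszul_lift_coeff; case: mnm_pivot => [v|//]; case: ifP => // _.
  rewrite memN_msupp_eq0 ?mulr0 // msize_mdeg_ge // mdegD mdeg1 addn1.
  by apply/leqW/(leq_trans _ hm); apply: leq_bigmax.
rewrite mcoeffZ mcoeffX; case: eqP => [e|]; last by rewrite mulr0.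
by move: lt_m'; rewrite e ltnNge hm.
Qed.

Lemma koszul_lift0 c S : (forall A, c A = 0) -> koszul_lift c S = 0.
Proof.
move=> c0; apply/mpolyP => m; rewrite mcoeff_koszul_lift mcoeff0.
rewrite /koszul_lift_coeff; case: mnm_pivot => // v; case: ifP => // _.
by rewrite c0 mcoeff0 mulr0.
Qed.

Lemma mcoeff_koszul (c : {set 'I_n} -> R^o) (S : {set 'I_n}) m :
  (K c S : R)@_m = \sum_(s | (s \notin S) && (0 < m s)%N)
    sgn s S * (c (s |: S) : R)@_(m - U_(s)).
Proof.
rewrite big_mkcondr raddf_sum /=; apply: eq_bigr => s _.
rewrite -[_ *: _]/(_ * _ : R) mcoeff_sign mcoeffXUM.
by case: ifP; rewrite ?mulr0.
Qed.

Lemma set_mnmU1 (v : 'I_n) (A : {set 'I_n}) : v \notin A ->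
  set_mnm (v |: A) = (U_(v) + set_mnm A)%MM.
Proof.
move=> vA; apply/mnmP => i; rewrite mnmDE !mnmE !inE eq_sym.
by case: eqP => [<-|]; rewrite ?(negPf vA).
Qed.

Lemma koszul_exact (c : {set 'I_n} -> R^o) :
    (forall S, K c S = 0) -> c set0 = 0 ->
  forall S, K (koszul_lift c : {set 'I_n} -> R^o) S = c S.
Proof.
move=> Kc0 c0 S; apply/mpolyP => m; rewrite mcoeff_koszul.
rewrite (eq_bigr (fun s => sgn s S *
  koszul_lift_coeff c (s |: S) (m - U_(s))%MM)) => [|s _]; last first.
  by rewrite mcoeff_koszul_lift.
pose b := (m + set_mnm S)%MM.
have bE s : s \notin S -> (0 < m s)%N -> (m - U_(s) + set_mnm (s |: S))%MM = b.
  move=> sS ms; rewrite set_mnmU1 // addmA submK //.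
  by rewrite lep1mP -lt0n.
rewrite (eq_bigr (fun s => if mnm_pivot b is Some v then
   if v \in s |: S then sgn s S *
     (sgn v ((s |: S) :\ v) *
        (c ((s |: S) :\ v))@_(m - U_(s) + U_(v))) else 0 else 0)); last first.
  move=> s /andP[sS ms]; rewrite /koszul_lift_coeff bE //.
  by case: mnm_pivot => [v|]; [case: ifP|]; rewrite ?mulr0.
rewrite /mnm_pivot; case: pickP => [v bv|b0]; last first.
  rewrite big1 //; suff -> : S = set0 by rewrite c0 mcoeff0.
  apply/setP => i; have := b0 i; rewrite inE mnmDE mnmE.
  by case: (i \in S) => //; rewrite addn1.
have [vS|vS] := boolP (v \in S); last first.
  have mv : (0 < m v)%N by move: bv; rewrite mnmDE mnmE (negPf vS) addn0.
  rewrite (bigD1 v) ?vS //= big1 => [|s /andP[/andP[sS _] sv]]; last first.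
    by rewrite !inE eq_sym (negPf sv) (negPf vS).
  rewrite setU11 setU1K // submK ?lep1mP -?lt0n //.
  by rewrite addr0 mulrA koszul_signK mul1r.
pose A := S :\ v; have vA : v \notin A by rewrite !inE eqxx.
have SE : S = v |: A by rewrite setD1K.
have := congr1 (mcoeff (m + U_(v))) (Kc0 A); rewrite mcoeff_koszul mcoeff0.
rewrite (bigD1 v) /=; last by rewrite vA mnmDE mnm1E eqxx addn1.
rewrite -SE addmK => /eqP.
rewrite addr_eq0 => /eqP/(congr1 ( *%R (sgn v A))).
rewrite mulrA koszul_signK mul1r => ->; rewrite mulrN mulr_sumr -sumrN.
apply: eq_big => [s|s /andP[sS ms]].
  rewrite SE in_setU1 negb_or mnmDE mnm1E [v == s]eq_sym.
  by case: (eqVneq s v); rewrite ?andbF //= addn0 andbT.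
rewrite setU1r // mulrA.
have sv : s != v by apply: contraNneq sS => ->.
have sA : s \notin A by rewrite !inE negb_and sS orbT.
have -> : (s |: S) :\ v = s |: A.
  apply/setP => y; rewrite !inE; case: (eqVneq y v) => [->|] //=.
  by rewrite eq_sym (negPf sv).
rewrite {1}SE koszul_signUU // mulNr; congr (- _).
rewrite -mulrA; congr (_ * (_ * _)); congr _@__; apply/mnmP => i.
by rewrite !mnmE; case: (eqVneq s i) => [<-|] /=; rewrite ?subn0 ?addnBAC.
Qed.

End KoszulExact.

Lemma fglift_linear (R : nzRingType) (N : choiceType) (M : lmodType R)
  (f : N -> M) : linear (fglift f : {freeg N / R} -> M).
Proof.
have liftB := lift_is_additive f.
have lift0 : fglift f 0 = 0 by rewrite -[0 in LHS]subr0 liftB subrr.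
have liftD u v : fglift f (u + v) = fglift f u + fglift f v.
  by rewrite -{1}[v]opprK liftB -[- v]add0r liftB lift0 add0r opprK.
have lift_sum (s : seq N) (g : N -> R) :
    fglift f (\sum_(x <- s) << g x *g x >>) = \sum_(x <- s) g x *: f x.
  elim: s => [|x s IHs]; first by rewrite !big_nil lift0.
  by rewrite !big_cons liftD liftU IHs.
move=> a u v; rewrite liftD; congr (_ + _).
rewrite -[a *: u]/(fgscale a u) -{2}[u]freeg_sumE !lift_sum scaler_sumr.
by apply: eq_bigr => x _; rewrite scalerA.
Qed.

Lemma fglift_sum (R : nzRingType) (N : choiceType) (M : lmodType R)
  (f : N -> M) (u : {freeg N / R}) :
  fglift f u = \sum_(x <- dom u) coeff x u *: f x.
Proof.
pose F : {linear {freeg N / R} -> M} := HB.pack (fglift f)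
  (GRing.isLinear.Build _ _ _ _ (fglift f) (fglift_linear f)).
rewrite -{1}[u]freeg_sumE -[fglift f _]/(F _) linear_sum.
by apply: eq_bigr => x _; rewrite /= liftU.
Qed.

Lemma coeff_sum_uniq (R : nzRingType) (N : choiceType) (s : seq N) (g : N -> R)
    x : uniq s ->
  coeff x (\sum_(y <- s) << g y *g y >>) = if x \in s then g x else 0.
Proof.
move=> s_uniq; rewrite raddf_sum /=; case: ifPn => xs.
  rewrite (bigD1_seq x) //= coeffU eqxx mulr1 big1 ?addr0 //.
  by move=> y yx; rewrite coeffU (negPf yx) mulr0.
rewrite big_seq big1 // => y ys; rewrite coeffU.
by case: eqP => [e|]; [rewrite -e ys in xs | rewrite mulr0].
Qed.

Section KoszulSyzygy.
Variables (k : fieldType) (n : nat) (rho tau : 'I_n -> nat).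
Hypothesis rhoI : injective rho.
Local Notation R := {mpoly k[n]}.
Local Notation X := (fun s : 'I_n => 'X_s : R).
Local Notation K := (koszul X rho tau).
Local Notation phi := (meval (fun _ : 'I_n => 0 : k)).

Lemma coeff_koszul (N : choiceType) (c : {set 'I_n} -> {freeg N / R}) S x :
  coeff x (K c S) = K (fun A => coeff x (c A) : R^o) S.
Proof.
rewrite (@koszul_linear _ _ _ _ _ _ _ (coeff x : {freeg N / R} -> R^o)) //.
by move=> a u v; rewrite coeffD coeffZ.
Qed.

Lemma koszul_exact_free (N : choiceType) (c : {set 'I_n} -> {freeg N / R}) :
    (forall S, K c S = 0) -> c set0 = 0 ->
  exists y : {set 'I_n} -> {freeg N / R}, forall S, K y S = c S.
Proof.
move=> Kc0 c0.
pose D := undup (flatten [seq dom (c A) | A <- enum {: {set 'I_n}}]).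
pose y S : {freeg N / R} :=
  \sum_(x <- D) << koszul_lift rho tau (fun A => coeff x (c A)) S *g x >>.
have yE x S : coeff x (y S) = koszul_lift rho tau (fun A => coeff x (c A)) S.
  rewrite coeff_sum_uniq ?undup_uniq //; case: ifPn => // xD.
  rewrite koszul_lift0 // => A.
  apply: coeff_outdom; apply: contra xD => xA; rewrite mem_undup.
  by apply/flatten_mapP; exists A; rewrite ?mem_enum.
exists y => S; apply/eqP/freeg_eqP => x; rewrite coeff_koszul.
rewrite (@eq_koszul _ _ _ _ _ R^o _ _ (yE x)).
rewrite (koszul_exact rhoI) ?c0 ?coeff0 // => A.
by rewrite -coeff_koszul Kc0 coeff0.
Qed.

Definition koszul_class (M : lmodType R) (j : nat) (z : {set 'I_n} -> M) :=
  [/\ forall S : {set 'I_n}, #|S| != j -> z S = 0, forall S, K z S = 0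
    & ~ exists y, forall S, K y S = z S].

Lemma base_change_koszul (N : choiceType) (c : {set 'I_n} -> {freeg N / R}) S :
  base_change phi (K c S) = 0.
Proof.
rewrite /base_change big1 // => x _; rewrite coeff_koszul.
suff e : phi (K (fun A => coeff x (c A) : R^o) S) = 0.
  by rewrite [X in << X *g _ >>]e freegU0.
rewrite /koszul raddf_sum big1 //= => s _.
by rewrite -[_ *: _]/(_ * (_ * _) : R) !mevalM mevalXU mul0r mulr0.
Qed.

(* The connecting map of the long exact Koszul homology sequence of
   0 -> syzygy M -> {freeg M / R} -> M -> 0. *)
Lemma koszul_class_syzygy (M : lmodType R) j (z : {set 'I_n} -> M) :
    koszul_class j.+1 z ->
  exists2 z' : {set 'I_n} -> syzygy M, koszul_class j z' &
    forall S, base_change phi (syzygy_val (z' S)) = 0.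
Proof.
case=> z_deg Kz z_nb.
have cover_lin := fglift_linear (id : M -> M).
have val_lin : linear (@syzygy_val R M).
  by move=> a u v; rewrite -[LHS]/(val _) linearP.
have val0 : syzygy_val (0 : syzygy M) = 0 by rewrite -[LHS]/(val _) raddf0.
pose zt (S : {set 'I_n}) : {freeg M / R} :=
  if #|S| == j.+1 then << 1 *g z S >> else 0.
have cover_zt S : free_cover (zt S) = z S.
  rewrite /zt /free_cover; case: ifPn => [_|/z_deg ->].
    by rewrite liftU scale1r.
  by rewrite -[0 in LHS]subr0 lift_is_additive subrr.
have Kzt S : K zt S \in @syzygy_pred R M.
  rewrite inE /free_cover -(koszul_linear _ _ _ _ _ cover_lin).
  by rewrite (eq_koszul _ _ _ cover_zt) Kz.
exists (fun S => Syzygy (Kzt S)) => [|S]; last exact: base_change_koszul.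
split=> [S Sj|S|].
- apply/val_inj; rewrite [RHS]val0 /= /koszul big1 // => s sS.
  by rewrite /zt cardsU1 sS add1n eqSS (negPf Sj) !scaler0.
- apply/val_inj; rewrite /= [RHS]val0 -[LHS](koszul_linear _ _ _ _ _ val_lin).
  by rewrite koszul_koszul.
case=> y Ky; apply: z_nb.
pose y1 (S : {set 'I_n}) := if #|S| == j.+1 then y S else 0.
have [||Z KZ] := @koszul_exact_free M (fun S => zt S - syzygy_val (y1 S)).
- move=> S; rewrite koszulB koszul_linear //.
  have [Sj|Sj] := eqVneq #|S| j; last first.
    rewrite /koszul !big1 ?val0 ?subrr // => s sS.
      by rewrite /y1 cardsU1 sS add1n eqSS (negPf Sj) !scaler0.
    by rewrite /zt cardsU1 sS add1n eqSS (negPf Sj) !scaler0.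
  have -> : K y1 S = K y S.
    by apply: eq_bigr => s sS; rewrite /y1 cardsU1 sS Sj eqxx.
  by rewrite Ky /= subrr.
- by rewrite /zt /y1 cards0 /= subr0.
exists (fun S => free_cover (Z S)) => S; rewrite koszul_linear // KZ.
have cover_y : free_cover (syzygy_val (y1 S)) = 0.
  by apply/eqP/(syzygy_valP (y1 S)).
by rewrite /free_cover lift_is_additive -!/(free_cover _) cover_y
  subr0 cover_zt.
Qed.

End KoszulSyzygy.

Section Maximal.
Variables (k : fieldType) (n : nat).
Local Notation R := {mpoly k[n]}.
Local Notation phi := (meval (fun _ : 'I_n => 0 : k)).

Definition in_irrelevant (V : lmodType R) (y : V) :=
  exists g : 'I_n -> V, y = \sum_s ('X_s : R) *: g s.

Lemma in_irrelevantX (V : lmodType R) s (y : V) :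
  in_irrelevant (('X_s : R) *: y).
Proof.
exists (fun t => if t == s then y else 0); rewrite (bigD1 s) //= eqxx.
by rewrite big1 ?addr0 // => t /negPf ->; rewrite scaler0.
Qed.

Lemma in_irrelevantD (V : lmodType R) (y1 y2 : V) :
  in_irrelevant y1 -> in_irrelevant y2 -> in_irrelevant (y1 + y2).
Proof.
case=> g1 -> [g2 ->]; exists (fun s => g1 s + g2 s).
by rewrite -big_split; apply: eq_bigr => s _; rewrite scalerDr.
Qed.

Lemma in_irrelevant_sum (V : lmodType R) (I : eqType) (r : seq I) (y : I -> V) :
  (forall i, i \in r -> in_irrelevant (y i)) ->
  in_irrelevant (\sum_(i <- r) y i).
Proof.
move=> ym; rewrite big_seq; elim/big_ind: _ => //; last exact: in_irrelevantD.
by exists (fun=> 0); rewrite big1 // => s _; rewrite scaler0.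
Qed.

Lemma in_irrelevantZ (V : lmodType R) (a : R) (y : V) :
  in_irrelevant y -> in_irrelevant (a *: y).
Proof.
case=> g ->; exists (fun s => a *: g s); rewrite scaler_sumr.
by apply: eq_bigr => s _; rewrite !scalerA mulrC.
Qed.

Lemma mpoly_irrelevant (p : R) : phi p = 0 -> in_irrelevant (p : R^o).
Proof.
move=> p0; pose q := p - (p@_0%MM)%:MP.
have qm : in_irrelevant (q : R^o).
  rewrite [q]mpolyE; apply: in_irrelevant_sum => m.
  rewrite mcoeff_msupp => qm; rewrite -mul_mpolyC.
  apply: (@in_irrelevantZ R^o).
  have [i mi] : exists i, m i != 0%N.
    apply/existsP; apply: contraNT qm; rewrite negb_exists => /forallP m0.
    have -> : m = 0%MM by apply/mnmP => i; rewrite mnm0E; apply/eqP/negPn.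
    by rewrite mcoeffB mcoeffC eqxx mulr1 subrr.
  have le_im : (U_(i) <= m)%MM by rewrite lep1mP.
  rewrite -(submK le_im) addmC mpolyXD.
  exact: (@in_irrelevantX R^o).
have q0 : phi q = 0.
  case: qm => g ->; rewrite raddf_sum big1 //= => s _.
  by rewrite -[_ *: _]/(_ * _ : R) mevalM mevalXU mul0r.
rewrite (_ : p = q) //; apply/eqP; rewrite -subr_eq0 opprB addrC subrK.
move: q0; rewrite /q mevalB p0 sub0r mevalC => /eqP.
by rewrite oppr_eq0 => /eqP ->.
Qed.

Lemma in_irrelevant_scale (V : lmodType R) (p : R) (x : V) :
  phi p = 0 -> in_irrelevant (p *: x).
Proof.
move/mpoly_irrelevant => [g ->]; exists (fun s => (g s : R) *: x).
by rewrite scaler_suml; apply: eq_bigr => s _; rewrite scalerA.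
Qed.

End Maximal.

Section KoszulTor.
Variables (k : fieldType) (n : nat) (rho tau : 'I_n -> nat).
Hypothesis rhoI : injective rho.
Local Notation R := {mpoly k[n]}.
Local Notation X := (fun s : 'I_n => 'X_s : R).
Local Notation K := (koszul X rho tau).
Local Notation phi := (meval (fun _ : 'I_n => 0 : k)).

Lemma coeff_base_change (N : choiceType) (u : {freeg N / R}) x :
  coeff x (base_change phi u) = phi (coeff x u).
Proof.
rewrite /base_change coeff_sum_uniq ?uniq_dom //.
by case: ifPn => // /coeff_outdom ->; rewrite raddf0.
Qed.

Definition const_lift (N : choiceType) (v : {freeg N / k}) : {freeg N / R} :=
  \sum_(x <- dom v) << (coeff x v)%:MP *g x >>.

Lemma coeff_const_lift (N : choiceType) (v : {freeg N / k}) x :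
  coeff x (const_lift v) = (coeff x v)%:MP.
Proof.
rewrite /const_lift coeff_sum_uniq ?uniq_dom //.
by case: ifPn => // /coeff_outdom ->; rewrite raddf0.
Qed.

(* Hence [<< 1 *g x >>] can only be a Tor boundary when [x] lies in
   [\sum_s 'X_s *: syz M i]. *)
Lemma tor_diff_irrelevant (M : lmodType R) (i : nat)
    (u : @tor_chains R k M i.+1) :
  in_irrelevant (free_cover (const_lift (tor_diff phi u))).
Proof.
pose F : {linear {freeg (syz M i) / R} -> syz M i} :=
  HB.pack (@free_cover R (syz M i))
  (GRing.isLinear.Build _ _ _ _ _ (fglift_linear (id : syz M i -> syz M i))).
pose c v := free_cover (const_lift v) : syz M i.
have cD v1 v2 : c (v1 + v2) = c v1 + c v2.
  rewrite /c -[RHS](raddfD F); congr free_cover.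
  by apply/eqP/freeg_eqP => x; rewrite coeffD !coeff_const_lift coeffD raddfD.
have cZ a v : c (a *: v) = a%:MP *: c v.
  rewrite /c -[RHS](linearZ_LR F); congr free_cover.
  by apply/eqP/freeg_eqP => x; rewrite coeffZ !coeff_const_lift coeffZ rmorphM.
have c0 : c 0 = 0 by rewrite -(scale0r 0) cZ mpolyC0 scale0r.
rewrite -/(c _) /tor_diff fglift_sum.
rewrite (big_morph c cD c0); apply: in_irrelevant_sum => z _; rewrite cZ.
apply: in_irrelevantZ; set y := syzygy_val z.
have y0 : free_cover y = 0 by apply/eqP/(syzygy_valP z).
have -> : c (base_change phi y) = F (const_lift (base_change phi y) - y).
  by rewrite raddfB [X in _ - X]y0 subr0.
rewrite [F _]fglift_sum.
apply: in_irrelevant_sum => x _; apply: in_irrelevant_scale.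
by rewrite coeffB coeff_const_lift coeff_base_change mevalB mevalC subrr.
Qed.

Lemma koszul_class_syz (M : lmodType R) m j (z : {set 'I_n} -> M) :
    koszul_class rho tau (m + j) z ->
  exists z' : {set 'I_n} -> syz M m, koszul_class rho tau j z'.
Proof.
elim: m j => [|m IHm] j; first by exists z.
rewrite addSnnS => /IHm[z' /(koszul_class_syzygy rhoI)[z'' z''_class _]].
by exists z''.
Qed.

Lemma koszul_class_betti (M : lmodType R) i (z : {set 'I_n} -> M) :
  koszul_class rho tau i.+1 z -> betti i.+1 M <> Some 0%N.
Proof.
rewrite -addn1 => /koszul_class_syz[z1 /(koszul_class_syzygy rhoI)[w]].
case=> w_deg _ w_nb w_val; rewrite addn1 /betti /tor_dim /subquot_dim.
case: pselect => // h; case: (cid h) => b /= dim_b [b0]; apply: w_nb.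
case: dim_b; rewrite b0 => f _ fB.
pose w0 : syz M i.+1 := w set0.
have [|a [[u eu] _]] := fB (<< 1 *g w0 >> : @tor_chains R k M i.+1).
  by rewrite /= /tor_diff liftU w_val scaler0.
move: eu; rewrite big_ord0 subr0 => eu.
have [g eg] := tor_diff_irrelevant u; rewrite -{}eu in eg.
have {eg} eg : w0 = \sum_s ('X_s : R) *: g s.
  rewrite -eg (_ : const_lift _ = << 1 *g w0 >>).
    by rewrite /free_cover liftU scale1r.
  apply/eqP/freeg_eqP => x.
  by rewrite coeff_const_lift !coeffU !mul1r rmorph_nat.
exists (fun S => if [pick s | S == [set s]] is Some s then
  koszul_sign R rho tau s set0 *: g s else 0) => S.
have [S0|S0] := eqVneq S set0; last first.
  rewrite (w_deg S) ?cards_eq0 // /koszul big1 // => s sS.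
  case: pickP => [t /eqP e|]; last by rewrite !scaler0.
  have := cards1 t; rewrite -e cardsU1 sS add1n => -[/eqP].
  by rewrite cards_eq0 (negPf S0).
rewrite S0 -/w0 eg /koszul; apply: eq_big => [s|s _]; first by rewrite inE.
rewrite setU0; case: pickP => [t /eqP/set1_inj <-|/(_ s)]; last by rewrite eqxx.
by rewrite !scalerA mulrAC koszul_signK mul1r.
Qed.

End KoszulTor.

Section Coboundary.
Variables (k : fieldType) (U : finType) (D : {set {set U}}).
Hypothesis D_closed : forall F G : {set U}, G \subset F -> F \in D -> G \in D.

Definition coboundary (v : {set U} -> k) (F : {set U}) : k :=
  \sum_(u in F)
    (-1) ^+ #|[set y in F | (enum_rank y < enum_rank u)%N]| * v (F :\ u).

Lemma bdry_mul_col c (v : {set U} -> k) :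
  bdry k D c *m (\col_i v (enum_val i)) = \col_i coboundary v (enum_val i).
Proof.
apply/matrixP => i o; rewrite !mxE; set F := enum_val i.
have: F \in faces D c.+1 by apply: enum_valP.
rewrite inE => /andP[FD /eqP F_card].
under eq_bigr => j _ do rewrite !mxE mulr_suml.
rewrite (exchange_big_dep (mem F)) /= => [|j u _ /andP[]//].
apply: eq_bigr => u uF.
have Fu : F :\ u \in faces D c.
  rewrite inE (D_closed (subsetDl _ _) FD).
  by rewrite -eqSS -F_card (cardsD1 u F) uF add1n eqxx.
rewrite (big_pred1 (enum_rank_in Fu (F :\ u))) => [|j].
  by rewrite enum_rankK_in.
by rewrite -/F uF /= -(inj_eq enum_val_inj) enum_rankK_in // eq_sym.
Qed.

Lemma homology_cocycle j : reduced_homology_dim k D j <> 0%N ->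
  exists v : {set U} -> k,
    [/\ forall F : {set U}, #|F| != j.+1 -> v F = 0,
        forall F, F \in D -> coboundary v F = 0 &
        ~ exists w, forall F : {set U}, F \in D -> #|F| = j.+1 ->
          v F = coboundary w F].
Proof.
rewrite /reduced_homology_dim mxrank_ker.
set A := bdry k D j; set B := bdry k D j.+1 => dim_neq0.
have: ~~ (kermx B^T <= A^T)%MS.
  apply/negP => /mxrankS; rewrite mxrank_ker !mxrank_tr => leA.
  case: dim_neq0; apply/eqP; rewrite subn_eq0 leq_subLR.
  by rewrite addnC -leq_subLR.
case/row_subPn => i; have: row i (kermx B^T) *m B^T = 0.
  by rewrite -row_mul mulmx_ker row0.
move: (row i _) => r rB rA.
pose v (F : {set U}) : k :=
  if [pick l : 'I_#|faces D j.+1| | enum_val l == F] is Some l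
  then r 0 l else 0.
have vE : \col_l v (enum_val l) = r^T.
  apply/matrixP => l o; rewrite !mxE ord1 /v.
  case: pickP => [l' /eqP/enum_val_inj -> //|/(_ l)]; by rewrite eqxx.
have v0 (F : {set U}) : #|F| != j.+1 -> v F = 0.
  move=> F_card; rewrite /v; case: pickP => // l /eqP e.
  by have := enum_valP l; rewrite e inE (negPf F_card) andbF.
exists v; split=> // [F FD|[w vw]].
  have [F_card|F_card] := eqVneq #|F| j.+2; last first.
    rewrite /coboundary big1 // => u uF; rewrite v0 ?mulr0 //.
    by move: F_card; rewrite (cardsD1 u) uF add1n.
  have Ff : F \in faces D j.+2 by rewrite inE FD F_card eqxx.
  have := bdry_mul_col j.+1 v; rewrite vE -/B -[B]trmxK -trmx_mul rB trmx0.
  move/matrixP/(_ (enum_rank_in Ff F) 0).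
  by rewrite !mxE enum_rankK_in.
case/negP: rA; apply/submxP; exists (\col_i w (enum_val i))^T.
rewrite -trmx_mul bdry_mul_col -[r]trmxK -vE; congr (_^T).
apply/matrixP => l o; rewrite !mxE.
by have := enum_valP l; rewrite inE => /andP[? /eqP ?]; apply: vw.
Qed.

Lemma homology_small j : (#|U| <= j.+1)%N -> reduced_homology_dim k D j = 0%N.
Proof.
move=> U_small; apply: contrapT => /homology_cocycle[v [_ _]]; apply.
have F_full (F : {set U}) : #|F| = j.+1 -> F = setT.
  move=> F_card; apply/eqP; rewrite eqEcard subsetT cardsT /=.
  by rewrite F_card.
case: (pickP (fun _ : U => true)) => [u _|U0]; last first.
  exists v => F _ F_card; have : F != set0 by rewrite -cards_eq0 F_card.
  by case/set0Pn => u _; have := U0 u.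
pose e : k := (-1) ^+ #|[set y in [set: U] | (enum_rank y < enum_rank u)%N]|.
exists (fun G => if G == setT :\ u then e * v setT else 0) => F _ /F_full ->.
rewrite /coboundary (bigD1 u) ?inE //= eqxx mulrA -expr2 sqrr_sign mul1r.
rewrite big1 ?addr0 // => t /andP[_ tu]; rewrite ifN ?mulr0 //.
by apply: contraNneq tu => /setP/(_ t); rewrite !inE eqxx; case: eqP.
Qed.

End Coboundary.

Section Quotmod.
Variables (R : nzRingType) (V : lmodType R) (J : submodClosed V).

Definition quotmod_pi (v : V) : quotmod J := (\pi_(quotmod J) v)%qT.

Lemma quotmod_pi_linear : linear quotmod_pi.
Proof.
move=> a u v; rewrite /quotmod_pi raddfD; congr (_ + _).
exact/esym/quotmod_scale_pi.
Qed.

Lemma quotmod_piK (q : quotmod J) : quotmod_pi (repr q) = q.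
Proof. exact: reprK. Qed.

Lemma quotmod_pi_eq (u v : V) : quotmod_pi u = quotmod_pi v <-> u - v \in J.
Proof.
split=> [/eqP|uv]; rewrite /quotmod_pi ?piE; last apply/eqP; rewrite ?piE.
  by rewrite Quotient.equivE.
by rewrite Quotient.equivE.
Qed.

End Quotmod.

Section Multidegree.
Variables (k : fieldType) (n : nat) (U : finType) (iota : U -> 'I_n).
Hypothesis iotaI : injective iota.
Variable (D : {set {set U}}).
Local Notation R := {mpoly k[n]}.
Local Notation X := (fun s : 'I_n => 'X_s : R).
Variable J : submodClosed R^o.
Local Notation mon F := (set_mnm (iota @: F)).
Hypothesis nonface_J : forall F : {set U}, F \notin D -> 'X_[mon F] \in J.
Hypothesis face_J : forall (p : R) (F : {set U}),
  p \in J -> F \in D -> p@_(mon F) = 0.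

(* The ranking extends the vertex order of [U]; the twist below then makes the
   Koszul sign at the complement of a face [F] of [U] agree with the simplicial
   sign at [F]. *)
Definition subset_rank (i : 'I_n) : nat :=
  if [pick u | iota u == i] is Some u then enum_rank u else (#|U| + i)%N.

Definition subset_twist (i : 'I_n) : nat :=
  #|[set u : U | (enum_rank u < subset_rank i)%N]|.

Local Notation rho := subset_rank.
Local Notation tau := subset_twist.
Local Notation K := (koszul X rho tau).

Lemma subset_rank_iota u : rho (iota u) = enum_rank u.
Proof.
rewrite /rho; case: pickP => [v /eqP/iotaI -> //|/(_ u)].
by rewrite eqxx.
Qed.

Lemma subset_rank_inj : injective rho.
Proof.
have ltU (u : U) (i : 'I_n) : enum_rank u <> (#|U| + i)%N :> nat.
  by move=> e; have := ltn_ord (enum_rank u); rewrite e ltnNge leq_addr.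
move=> i i'; rewrite /rho; case: pickP => [u /eqP <-|_];
  case: pickP => [u' /eqP <-|_].
- by move/val_inj/enum_rank_inj ->.
- by move/ltU.
- by move/esym/ltU.
- by move/addnI/val_inj.
Qed.

Lemma koszul_sign_iota (A : comNzRingType) (u : U) (F : {set U}) :
  koszul_sign A rho tau (iota u) (iota @: (~: F)) =
  (-1) ^+ #|[set y in F | (enum_rank y < enum_rank u)%N]|.
Proof.
rewrite /koszul_sign /tau subset_rank_iota.
set L := [set v : U | _].
have -> : [set y in iota @: (~: F) | (rho y < enum_rank u)%N]
    = iota @: (L :\: F).
  apply/setP => y; rewrite inE; apply/andP/imsetP => [[/imsetP[v vF ->]]|[v]].
    rewrite subset_rank_iota => vu; exists v => //.
    by rewrite !inE vu andbT -in_setC.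
  rewrite !inE => /andP[vF vu] ->; rewrite subset_rank_iota; split=> //.
  by rewrite imset_f // inE.
rewrite card_imset // -(cardsID F L) addnC -addnA exprD addnn -mul2n exprM.
rewrite sqrrN !expr1n mulr1; congr (_ ^+ _).
by apply: eq_card => y; rewrite !inE andbC.
Qed.

Definition face_of (S : {set 'I_n}) : {set U} := iota @^-1: ~: S.

(* In multidegree [iota @: setT] the Koszul complex is the cochain complex of
   the full simplex on [U]: the face [F] corresponds to ['X_[mon F] e_S] with
   [S] the image of the complement of [F]. *)
Definition koszul_of_cochain (v : {set U} -> k) (S : {set 'I_n}) : R^o :=
  if S \subset iota @: setT
  then v (face_of S) *: 'X_[mon (face_of S)] : R else 0.

Lemma face_ofK (S : {set 'I_n}) :
  S \subset iota @: setT -> iota @: (~: face_of S) = S.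
Proof.
move=> SU; apply/setP => s; apply/imsetP/idP => [[u]|sS].
  by rewrite !inE negbK => uS ->.
by have /imsetP[u _ e] := subsetP SU _ sS; exists u; rewrite // !inE negbK -e.
Qed.

Lemma setU1_iota u (F : {set U}) : u \in F ->
  iota u |: iota @: (~: F) = iota @: (~: (F :\ u)).
Proof.
by move=> uF; rewrite setCD imsetU imset_set1 setUC.
Qed.

Lemma mon_D1 u (F : {set U}) :
  u \in F -> mon F = (U_(iota u) + mon (F :\ u))%MM.
Proof.
move=> uF; rewrite -{1}(setD1K uF) imsetU1 set_mnmU1 //.
by rewrite mem_imset // !inE eqxx.
Qed.

Lemma face_of_iota (F : {set U}) : face_of (iota @: (~: F)) = F.
Proof. by apply/setP => u; rewrite !inE mem_imset // !inE negbK. Qed.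

Lemma koszul_of_cochainE v (S : {set 'I_n}) :
  K (koszul_of_cochain v) S = koszul_of_cochain (coboundary v) S.
Proof.
rewrite {2}/koszul_of_cochain; case: ifPn => [SU|SU]; last first.
  rewrite /koszul big1 // => s _; rewrite /koszul_of_cochain ifN ?scaler0 //.
  by apply: contraNN SU => /(subset_trans (subsetUr _ _)).
set F := face_of S; have SE := face_ofK SU.
rewrite /koszul (bigID (mem (iota @: F))) /= addrC big1 ?add0r => [|s];
  last first.
  case/andP=> sS sF; rewrite /koszul_of_cochain ifN ?scaler0 //.
  apply: contra sF; rewrite subUset sub1set => /andP[/imsetP[u _ e] _].
  by rewrite e imset_f // !inE -e.
rewrite (eq_bigl (mem (iota @: F))) => [|s]; last first.
  rewrite andb_idl // => /imsetP[u]; rewrite !inE => uS ->; exact: uS.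
rewrite big_imset; last by move=> ? ? _ _; apply: iotaI.
rewrite /coboundary scaler_suml; apply: eq_bigr => u uF.
rewrite -{2}SE -/F setU1_iota // /koszul_of_cochain imsetS ?subsetT //.
rewrite face_of_iota -{1}SE -/F koszul_sign_iota (mon_D1 uF) mpolyXD.
rewrite -[_ *: (_ *: _)]/(_ * (_ * _) : R) -!mul_mpolyC.
by rewrite mpolyCM rmorph_sign -!mulrA [X in _ * X]mulrCA.
Qed.

Lemma cochain_koszul_class j (v : {set U} -> k) :
  (forall F : {set U}, #|F| != j.+1 -> v F = 0) ->
  (forall F, F \in D -> coboundary v F = 0) ->
  ~ (exists w, forall F : {set U}, F \in D -> #|F| = j.+1 ->
          v F = coboundary w F) ->
  koszul_class rho tau (#|U| - j.+1) 
    (fun S => quotmod_pi J (koszul_of_cochain v S)).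
Proof.
move=> v_deg v_cocycle v_nb.
have pi_lin := quotmod_pi_linear J.
have pi0 : quotmod_pi J 0 = 0 by rewrite /quotmod_pi raddf0.
split=> [S S_card|S|[y Ky]].
- rewrite /koszul_of_cochain; case: ifP => // SU.
  rewrite v_deg ?scale0r //; apply: contra S_card => /eqP e.
  rewrite -[in #|S|](face_ofK SU) card_imset // -e.
  by rewrite -(cardsC (face_of S)) addKn.
- rewrite koszul_linear // koszul_of_cochainE /koszul_of_cochain.
  case: ifP => // SU; set F := face_of S.
  have [FD|FD] := boolP (F \in D); first by rewrite v_cocycle // scale0r.
  rewrite -pi0; apply/quotmod_pi_eq; rewrite subr0 -mul_mpolyC.
  exact: (rpredZ (_%:MP) (nonface_J FD)).
apply: v_nb.
exists (fun G : {set U} => (repr (y (iota @: (~: G))) : R)@_(mon G)).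
move=> F FD F_card.
pose p (A : {set 'I_n}) : R^o := repr (y A).
have: quotmod_pi J (koszul_of_cochain v (iota @: (~: F))) =
      quotmod_pi J (K p (iota @: (~: F))).
  rewrite -Ky -koszul_linear //; apply: eq_koszul => A.
  by rewrite quotmod_piK.
move/quotmod_pi_eq/face_J/(_ FD)/eqP.
rewrite mcoeffB subr_eq0 /koszul_of_cochain imsetS ?subsetT // face_of_iota.
rewrite mcoeffZ mcoeffX eqxx mulr1 => /eqP ->; rewrite mcoeff_koszul.
rewrite (eq_bigl (mem (iota @: F))) => [|s]; last first.
  rewrite mnmE lt0b andb_idl // => /imsetP[u uF ->].
  by rewrite mem_imset // inE negbK.
rewrite big_imset; last by move=> ? ? _ _; apply: iotaI.
apply: eq_bigr => u uF.
rewrite koszul_sign_iota setU1_iota //.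
by rewrite (mon_D1 uF) addmC addmK.
Qed.

End Multidegree.

Section CliqueComplex.
Variables (k : fieldType) (T : finType) (d : nat) (H : hypergraph T).
Local Notation Delta := (clique_complex d H).

Lemma clique_complex_closed (F G : {set T}) :
  G \subset F -> F \in Delta -> G \in Delta.
Proof.
move=> GF; rewrite !inE => /forallP F_clique; apply/forallP => e.
apply/implyP => /andP[eG e_card]; apply: (implyP (F_clique e)).
by rewrite (subset_trans eG GF).
Qed.

Lemma induced_clique_complex (Y : {set T}) (F : {set {x | x \in Y}}) :
  (F \in clique_complex d (induced H Y)) = (val @: F \in Delta).
Proof.
rewrite !inE; apply/forallP/forallP => F_clique e; apply/implyP;
  case/andP=> eF e_card.
  have ee : val @: (val @^-1: e : {set {x | x \in Y}}) = e.
    apply/setP => x; apply/imsetP/idP => [[y]|xe]; first by rewrite inE => ? ->.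
    by have /imsetP[y yF ey] := subsetP eF _ xe; exists y; rewrite // inE -ey.
  have := implyP (F_clique (val @^-1: e)); rewrite inE ee; apply.
  rewrite -(card_imset _ val_inj) ee e_card andbT; apply/subsetP => y.
  by rewrite inE => /(subsetP eF); rewrite mem_imset //; apply: val_inj.
rewrite inE; apply: (implyP (F_clique _)).
by rewrite imsetS // card_imset //; apply: val_inj.
Qed.

Lemma face_monomialE (F : {set T}) :
  face_monomial k F = 'X_[set_mnm (enum_rank @: F)].
Proof.
rewrite /face_monomial mprodXE; congr 'X_[_]; apply/mnmP => i.
rewrite mnm_sumE mnmE -(enum_valK i) mem_imset; last exact: enum_rank_inj.
under eq_bigr => x _ do rewrite mnm1E (inj_eq enum_rank_inj).
have [xF|xF] := boolP (enum_val i \in F).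
  rewrite (bigD1 (enum_val i)) //= eqxx big1 // => x /andP[_ /negPf ->] //.
by rewrite big1 // => x xG; case: eqP => // e; rewrite -e xG in xF.
Qed.

Lemma sr_ideal_nonface (F : {set T}) : F \notin Delta ->
  'X_[set_mnm (enum_rank @: F)] \in @sr_ideal k T Delta.
Proof.
move=> FD; apply/asboolP; exists (fun G => (G == F)%:R).
rewrite (bigD1 F) //= eqxx mul1r face_monomialE big1 ?addr0 // => G.
by case/andP=> _ /negPf ->; rewrite mul0r.
Qed.

Lemma sr_ideal_face (p : {mpoly k[#|T|]}) (F : {set T}) :
  p \in @sr_ideal k T Delta -> F \in Delta -> p@_(set_mnm (enum_rank @: F)) = 0.
Proof.
move=> /asboolP[c ->] FD; rewrite raddf_sum big1 // => G GD.
rewrite face_monomialE [LHS](mcoeffM (c G : {mpoly k[#|T|]})).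
rewrite big1 // => -[m1 m2] /= /eqP e; rewrite mcoeffX.
case: eqP => [e2|_]; last by rewrite mulr0.
case/negP: GD; apply: clique_complex_closed FD; apply/subsetP => x xG.
move/(congr1 (fun m : 'X_{1..#|T|} => m (enum_rank x))): e.
rewrite mnmDE -e2 !mnmE !mem_imset; try exact: enum_rank_inj.
by rewrite xG addn1; case: (x \in F).
Qed.

End CliqueComplex.

Lemma not_homologically_connected (k : fieldType) (T : finType) (d : nat)
    (H : hypergraph T) :
  ~ homologically_connected k d H ->
  reduced_homology_dim k (clique_complex d H) (d - 2) <> 0%N.
Proof.
move=> /contrapT; rewrite /con; case: pickP => // V0 PV0 /= [].
case: arg_minnP => // V PV _ /eqP; rewrite cards_eq0 => /eqP V_eq0.
move: PV; rewrite V_eq0 setC0 (_ : restrict _ _ = clique_complex d H).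
  by move/eqP.
by apply/setP => F; rewrite !inE subsetT andbT.
Qed.

Local Close Scope ring_scope.

Theorem proposition5p5 (k : fieldType) (T : finType) (d : nat)
    (H : hypergraph T) (Y : {set T}) :
  2 <= d ->
  uniform d H ->
  ~ homologically_connected k d (induced H Y) ->
  betti (#|Y| - d + 1) (sr_quotient k (clique_complex d H)) <> Some 0.
Proof.
move=> d_ge2 _ /not_homologically_connected.
set D := clique_complex d (induced H Y) => D_homology.
pose U : finType := {x : T | x \in Y}.
have D_closed : forall F G : {set U}, G \subset F -> F \in D -> G \in D.
  exact: clique_complex_closed.
have UY : #|U| = #|Y| by rewrite card_sig.
have d_le : (d <= #|Y|)%N.
  rewrite leqNgt; apply/negP => Y_small; apply: D_homology.
  apply: homology_small => //.
  by rewrite UY subnSK // subn1 -ltnS prednK // ltnW.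
have [v [v_deg v_cocycle v_nb]] := homology_cocycle D_closed D_homology.
pose iota (x : U) := enum_rank (val x).
have iotaI : injective iota by move=> x y /enum_rank_inj/val_inj.
have imE (F : {set U}) : iota @: F = enum_rank @: (val @: F).
  by rewrite -imset_comp.
pose J : submodClosed (poly_ring k T)^o := @sr_ideal k T (clique_complex d H).
have nonface_J (F : {set U}) : F \notin D -> 'X_[set_mnm (iota @: F)] \in J.
  by rewrite imE induced_clique_complex; apply: sr_ideal_nonface.
have face_J (p : {mpoly k[#|T|]}) (F : {set U}) :
    p \in J -> F \in D -> (p@_(set_mnm (iota @: F)) = 0)%R.
  by rewrite imE induced_clique_complex; apply: sr_ideal_face.
have := cochain_koszul_class iotaI nonface_J face_J v_deg v_cocycle v_nb.
have -> : (#|U| - (d - 2).+1 = (#|Y| - d).+1)%N.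
  by rewrite UY subnSK // subnBA ?(ltnW d_ge2) // addn1 subSn.
rewrite addn1; apply: koszul_class_betti; exact: subset_rank_inj.
Qed.
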